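(* There exists an absolute constant $k>0$ for which the following holds. For every $0<\varepsilon<1/2$ there is a set $\Omega$ and a class $F$ of real-valued functions on $\Omega$ bounded by $1$ in absolute value such that $$\mathrm{vc}(\mathrm{conv}(F),\varepsilon)\ge\frac{k\cdot\mathrm{vc}(F,\varepsilon)}{\varepsilon^2\log(1/\varepsilon)}.$$
   Context: A subset $\sigma\subset\Omega$ is $t$-shattered by a class $F$ of real-valued functions on $\Omega$ if there is a function $h:\sigma\to\mathbb{R}$ such that for every $\sigma'\subset\sigma$ there is $f\in F$ with $f(x)\le h(x)-t$ for $x\in\sigma'$ and $f(x)\ge h(x)+t$ for $x\in\sigma\setminus\sigma'$. The shattering dimension $\mathrm{vc}(F,t)$ is the maximal cardinality of a subset of $\Omega$ that is $t$-shattered by $F$. $\mathrm{conv}(F)$ is the convex hull of $F$. *)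

(* Defs.v *)
From HB Require Import structures.
From mathcomp Require Import all_boot all_order all_algebra.
From mathcomp Require Import all_classical all_reals all_analysis.

Set Implicit Arguments.
Unset Strict Implicit.
Unset Printing Implicit Defensive.

Import Order.TTheory GRing.Theory Num.Theory.

Local Open Scope classical_set_scope.
Local Open Scope ring_scope.

(* Only the values of [h] on [sigma] matter. *)
Definition shattered (R : realType) (Omega : Type) (F : set (Omega -> R))
    (t : R) (sigma : set Omega) : Prop :=
  exists h : Omega -> R,
    forall sigma' : set Omega, sigma' `<=` sigma ->
      exists f : Omega -> R,
        [/\ F f,
            forall x, sigma' x -> f x <= h x - t
          & forall x, (sigma `\` sigma') x -> h x + t <= f x].

(* The value is [+oo] when there are finite shattered sets of arbitrarily large
   cardinality (in particular when an infinite set is shattered), and [-oo]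
   when [F] is empty, since then even [set0] is not shattered. *)
Definition vc (R : realType) (Omega : Type) (F : set (Omega -> R)) (t : R) :
    \bar R :=
  ereal_sup [set n%:R%:E | n in
    [set n : nat | exists sigma : set Omega,
                     (sigma #= `I_n)%card /\ shattered F t sigma]].

Definition conv_hull (R : realType) (Omega : Type) (F : set (Omega -> R)) :
    set (Omega -> R) :=
  [set f | exists (n : nat) (a : 'I_n -> R) (g : 'I_n -> Omega -> R),
     [/\ forall i, 0 <= a i,
         \sum_(i < n) a i = 1,
         forall i, F (g i)
       & f = (fun x => \sum_(i < n) a i * g i x)]].

(* Main.v *)
Require Import Defs.
From HB Require Import structures.
From mathcomp Require Import all_boot all_order all_algebra.
From mathcomp Require Import all_classical all_reals all_analysis.
From mathcomp Require Import ring lra.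

(** The class [F] consists of the functions [w y] and [- w y], where [w y] runs
over the [m = 2 ^ j] Walsh functions on the cube [{0, 1} ^ j], and [j] is the
largest exponent with [2 ^ j * eps ^ 2 <= 1].

The dimension of [F] is small because [F] is small: shattering [n] points takes
[2 ^ n] different functions, and [F] has [2 ^ j.+1] of them, so that
[vc F eps <= j.+1], which is of order [ln (1 / eps)] ([card_shattered]).

The dimension of the convex hull is large because the Walsh functions are an
orthogonal basis whose members are bounded by [1].  A sign vector [s] on the
cube equals [\sum_y c y / m * w y] with [c y := \sum_z w y z * s z], and by
Parseval's identity [\sum_y (c y) ^ 2 = m ^ 2].  The inequality between the l1
and l2 norms gives [\sum_y `|c y / m| <= Num.sqrt m <= 1 / eps].  Hence [eps * s]
has l1 norm at most [1] in the basis [w], that is, it lies in the convex hull of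
[F] ([conv_hull_signed], [conv_hull_walsh_sign]).  As [s] is arbitrary, the hull
[eps]-shatters the whole cube, which has [2 ^ j > 1 / (2 * eps ^ 2)] points. *)

Set Implicit Arguments.
Unset Strict Implicit.
Unset Printing Implicit Defensive.

Import Order.TTheory GRing.Theory Num.Theory.

Local Open Scope classical_set_scope.
Local Open Scope ring_scope.

(** * Shattering by finite classes *)

Lemma vc_ge (R : realType) (Omega : Type) (F : set (Omega -> R)) (t : R)
    (sigma : set Omega) (n : nat) :
  (sigma #= `I_n)%card -> shattered F t sigma -> (n%:R%:E <= vc F t)%E.
Proof. by move=> cs sh; apply: ereal_sup_ubound; exists n => //; exists sigma. Qed.

Lemma card_setT_fintype (T : finType) : ([set: T] #= `I_#|T|)%card.
Proof.
apply/card_set_bijP; exists (fun x => enum_rank x : nat); split=> //.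
- by move=> x _; rewrite /= ltn_ord.
- by move=> x y _ _ /ord_inj /enum_rank_inj.
- by move=> i /= iT; exists (enum_val (Ordinal iT)); rewrite ?enum_valK.
Qed.

(** Two different subsets of a shattered set are cut out by different functions,
since [t > 0] separates their values at any point of the symmetric difference.
This makes the choice of a function for each subset injective. *)
Lemma card_shattered (R : realType) (Omega : Type) (T : finType)
    (g : T -> Omega -> R) (t : R) (sigma : set Omega) (n : nat) :
  0 < t -> (sigma #= `I_n)%card -> shattered (range g) t sigma ->
  (2 ^ n <= #|T|)%N.
Proof.
move=> t0 cs [h sh].
have [e e_bij] : exists e : [set: 'I_n] -> sigma, bijective e.
  by apply/card_bijP; rewrite card_eq_sym -(card_eqr card_II).
pose p (i : 'I_n) : Omega := val (e (SigSub (mem_setT i))).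
have p_sigma i : sigma (p i) by exact: set_valP.
have p_inj : injective p.
  by move=> i k /val_inj /(bij_inj e_bij) /(congr1 val).
have /choice[c c_cut] (A : {set 'I_n}) : exists y : T,
    (forall i, i \in A -> g y (p i) <= h (p i) - t) /\
    (forall i, i \notin A -> h (p i) + t <= g y (p i)).
  have sub : [set p i | i in [set` A]] `<=` sigma by move=> _ [i _ <-].
  have [_ [[y _ <-] lo hi]] := sh _ sub.
  exists y; split=> i iA; first by apply: lo; exists i.
  by apply: hi; split=> // -[k kA /p_inj ki]; move: iA; rewrite -ki kA.
have c_inj : injective c.
  move=> A B cAB; apply/setP => i; apply/idP/idP => iX; apply: contraT => iY.
    by have := (c_cut A).1 i iX; have := (c_cut B).2 i iY; rewrite cAB; lra.
  by have := (c_cut B).1 i iX; have := (c_cut A).2 i iY; rewrite cAB; lra.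
have := leq_card c c_inj.
by rewrite -cardsT -powersetT card_powerset cardsT card_ord.
Qed.

Lemma vc_range_le (R : realType) (Omega : Type) (T : finType)
    (g : T -> Omega -> R) (t : R) (k : nat) :
  0 < t -> (#|T| <= 2 ^ k)%N -> (vc (range g) t <= k%:R%:E)%E.
Proof.
move=> t0 Tk; apply: ge_ereal_sup => _ [n [sigma [cs sh]] <-].
by rewrite lee_fin ler_nat -(@leq_exp2l 2)// (leq_trans (card_shattered t0 cs sh)).
Qed.

(** * Convex hulls of symmetric finite classes *)

(** Indexing by a sign and a base function keeps the class the range of a map
from a finite type, also when the base functions are not distinct. *)
Definition signed (R : realType) (Omega I : Type) (w : I -> Omega -> R)
    (p : bool * I) : Omega -> R :=
  fun x => (-1) ^+ p.1 * w p.2 x.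

Lemma conv_hull_range (R : realType) (Omega : Type) (T : finType)
    (g : T -> Omega -> R) (a : T -> R) :
  (forall y, 0 <= a y) -> \sum_y a y = 1 ->
  conv_hull (range g) (fun x => \sum_y a y * g y x).
Proof.
move=> a_ge0 a1.
exists #|T|, (fun i => a (enum_val i)), (fun i => g (enum_val i)); split=> //.
- by rewrite -big_enum_val.
- apply/funext => x.
  by rewrite -(big_enum_val (fun y => a y * g y x)).
Qed.

(** Giving [w i] the weight [(u i + a i) / 2] and [- w i] the weight
[(u i - a i) / 2] spends the surplus of [u] over the absolute value of [a] on
opposite functions, which cancel. *)
Lemma conv_hull_signed (R : realType) (Omega : Type) (I : finType)
    (w : I -> Omega -> R) (a u : I -> R) :
  (forall i, `|a i| <= u i) -> \sum_i u i = 1 ->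
  conv_hull (range (signed w)) (fun x => \sum_i a i * w i x).
Proof.
move=> au u1.
pose q (p : bool * I) := (u p.2 + (-1) ^+ p.1 * a p.2) / 2.
have sumE (G : bool * I -> R) : \sum_p G p = \sum_i (G (true, i) + G (false, i)).
  rewrite (eq_bigr (fun p => G (p.1, p.2))) => [|[]//].
  by rewrite -(pair_bigA _ (fun b i => G (b, i)))/= big_bool -big_split.
have -> : (fun x => \sum_i a i * w i x) = (fun x => \sum_p q p * signed w p x).
  apply/funext => x; rewrite sumE; apply: eq_bigr => i _.
  by rewrite /q /signed /= expr0 expr1; field.
apply: conv_hull_range => [[b i]|].
  by have := au i; rewrite ler_norml /q /=; case: b; rewrite ?expr0 ?expr1; lra.
by rewrite sumE -[RHS]u1; apply: eq_bigr => i _; rewrite /q /= expr0 expr1; field.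
Qed.

(** * Walsh functions *)

Definition walsh (R : realType) (j : nat) (x y : {ffun 'I_j -> bool}) : R :=
  \prod_i (-1) ^+ (x i && y i).

Lemma normr_walsh (R : realType) (j : nat) (x y : {ffun 'I_j -> bool}) :
  `|walsh R x y| = 1.
Proof. by rewrite normr_prod big1// => i _; rewrite normrX normrN1 expr1n. Qed.

(** The sum over the cube factors into one sum per coordinate, and a coordinate
where [x] and [z] differ contributes the factor [1 - 1]. *)
Lemma walsh_orthogonal (R : realType) (j : nat) (x z : {ffun 'I_j -> bool}) :
  \sum_y walsh R y x * walsh R y z = (2 ^ j)%:R * (x == z)%:R.
Proof.
under eq_bigr => y _ do rewrite -big_split /=.
rewrite -(bigA_distr_bigA (fun i (b : bool) =>
  (-1) ^+ (b && x i) * (-1) ^+ (b && z i) : R)) /=.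
under eq_bigr => i _ do rewrite big_bool /= !expr0 mulr1 -signr_addb.
case: eqVneq => [->|xz].
  under eq_bigr => i _ do rewrite addbb expr0.
  by rewrite prodr_const card_ord mulr1 natrX.
have [i xzi] : exists i, x i != z i.
  by apply/existsP; rewrite -negb_forall; apply: contra xz => /eqfunP/ffunP ->.
rewrite mulr0 (bigD1 i)//=.
have -> : x i (+) z i = true by move: xzi; case: (x i); case: (z i).
by rewrite expr1 addNr mul0r.
Qed.

Lemma card_cube (j : nat) : #|{: {ffun 'I_j -> bool}}| = (2 ^ j)%N.
Proof. by rewrite card_ffun card_bool card_ord. Qed.

Definition walsh_coef (R : realType) (j : nat) (s : {ffun 'I_j -> bool} -> R)
    (y : {ffun 'I_j -> bool}) : R :=
  \sum_z walsh R y z * s z.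

Lemma walsh_inversion (R : realType) (j : nat) (s : {ffun 'I_j -> bool} -> R)
    (x : {ffun 'I_j -> bool}) :
  \sum_y walsh_coef s y * walsh R y x = (2 ^ j)%:R * s x.
Proof.
under eq_bigr => y _ do rewrite mulr_suml.
rewrite exchange_big /= (bigD1 x)//= [X in _ + X]big1 => [|z zx].
  rewrite addr0; under eq_bigr => y _ do rewrite mulrAC.
  by rewrite -mulr_suml walsh_orthogonal eqxx mulr1.
under eq_bigr => y _ do rewrite mulrAC.
by rewrite -mulr_suml walsh_orthogonal (negbTE zx) mulr0 mul0r.
Qed.

Lemma walsh_parseval (R : realType) (j : nat) (s : {ffun 'I_j -> bool} -> R) :
  \sum_y walsh_coef s y ^+ 2 = (2 ^ j)%:R * \sum_x s x ^+ 2.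
Proof.
rewrite mulr_sumr.
under [RHS]eq_bigr => x _ do rewrite expr2 mulrA -walsh_inversion mulr_suml.
rewrite exchange_big /=; apply: eq_bigr => y _.
by rewrite expr2 {2}/walsh_coef mulr_sumr; apply: eq_bigr => x _; rewrite mulrA.
Qed.

(** The l1 bound comes from the pointwise inequality [2 * `|v| <= v ^ 2 + 1]
for [v := eps * walsh_coef s y] in place of Cauchy-Schwarz; the resulting
majorant, completed by a constant to total mass [1], is the weight that
[conv_hull_signed] asks for. *)
Lemma conv_hull_walsh_sign (R : realType) (j : nat) (eps : R)
    (s : {ffun 'I_j -> bool} -> R) :
  (2 ^ j)%:R * eps ^+ 2 <= 1 -> (forall x, s x ^+ 2 = 1) ->
  conv_hull (range (signed (@walsh R j))) (fun x => eps * s x).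
Proof.
move=> meps s1; pose m : R := (2 ^ j)%:R.
have m0 : 0 < m by rewrite ltr0n expn_gt0.
have parseval : \sum_y walsh_coef s y ^+ 2 = m ^+ 2.
  rewrite walsh_parseval (eq_bigr _ (fun x _ => s1 x)).
  by rewrite sumr_const card_cube -/m expr2.
have -> : (fun x => eps * s x) =
    (fun x => \sum_y (eps / m * walsh_coef s y) * walsh R y x).
  apply/funext => x; under eq_bigr => y _ do rewrite -mulrA.
  by rewrite -mulr_sumr walsh_inversion -/m; field; rewrite gt_eqF.
pose u y := (eps ^+ 2 * walsh_coef s y ^+ 2 + (2 - m * eps ^+ 2)) / (2 * m).
apply: (@conv_hull_signed _ _ _ _ _ u) => [y|].
  have -> : eps / m * walsh_coef s y = (2 * (eps * walsh_coef s y)) / (2 * m).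
    by field; rewrite gt_eqF.
  have m2 : 0 < 2 * m by rewrite mulr_gt0.
  rewrite normrM normfV (gtr0_norm m2) ler_pM2r ?invr_gt0// ler_norml.
  have := sqr_ge0 (eps * walsh_coef s y - 1).
  have := sqr_ge0 (eps * walsh_coef s y + 1).
  by move: meps; rewrite -/m; nra.
rewrite -mulr_suml big_split /= -mulr_sumr parseval sumr_const card_cube.
by rewrite -mulr_natr -/m; field; rewrite gt_eqF.
Qed.

(** * Dimension of the Walsh class and of its hull *)

Lemma shattered_conv_hull_walsh (R : realType) (j : nat) (eps : R) :
  (2 ^ j)%:R * eps ^+ 2 <= 1 ->
  shattered (conv_hull (range (signed (@walsh R j)))) eps setT.
Proof.
move=> meps; exists (fun=> 0) => sigma' _.
exists (fun x => eps * (-1) ^+ (x \in sigma')); split.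
- by apply: conv_hull_walsh_sign => // x; rewrite sqrr_sign.
- by move=> x sx; rewrite (mem_set sx) expr1; lra.
- by move=> x [_ sx]; rewrite (memNset sx) expr0; lra.
Qed.

Lemma vc_conv_hull_walsh (R : realType) (j : nat) (eps : R) :
  (2 ^ j)%:R * eps ^+ 2 <= 1 ->
  ((2 ^ j)%:R%:E <= vc (conv_hull (range (signed (@walsh R j)))) eps)%E.
Proof.
move=> meps; apply: vc_ge (shattered_conv_hull_walsh meps).
by rewrite -card_cube; exact: card_setT_fintype.
Qed.

Lemma vc_signed_walsh_ge1 (R : realType) (j : nat) (eps : R) :
  eps <= 1 -> (1%:E <= vc (range (signed (@walsh R j))) eps)%E.
Proof.
move=> eps1; pose x0 : {ffun 'I_j -> bool} := [ffun=> false].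
apply: (@vc_ge _ _ _ _ [set x0] 1%N); first exact: card_set1.
exists (fun=> 0) => sigma' sub.
have w0 : walsh R x0 x0 = 1 by rewrite /walsh big1// => i _; rewrite ffunE expr0.
exists (signed (@walsh R j) (x0 \in sigma', x0)); split; first by eexists.
- move=> x sx; have xE : x = x0 by exact: sub.
  by rewrite xE in sx *; rewrite /signed/= (mem_set sx) expr1 w0; lra.
- move=> x [xE sx]; rewrite /= in xE; subst x.
  by rewrite /signed/= (memNset sx) expr0 w0; lra.
Qed.

Lemma exists_expn2_le (R : realType) (a : R) :
  1 <= a -> exists j, (2 ^ j)%:R <= a /\ a < (2 ^ j.+1)%:R.
Proof.
move=> a1; have a0 : 0 <= a by apply: le_trans a1.
exists (trunc_log 2 (Num.truncn a)).
have t0 : (0 < Num.truncn a)%N by rewrite truncn_gt0.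
rewrite -truncn_lt_nat// trunc_log_ltn//; split=> //.
by apply: le_trans (_ : (Num.truncn a)%:R <= a);
  rewrite ?ler_nat ?trunc_logP ?truncn_le.
Qed.

Theorem corollary4p5 (R : realType) :
  exists k : R, 0 < k /\
    forall eps : R, 0 < eps -> eps < 1 / 2 ->
      exists (Omega : Type) (F : set (Omega -> R)),
        [/\ forall f, F f -> forall x, `|f x| <= 1,
            (0 < vc F eps < +oo)%E
          & (k%:E * vc F eps * ((eps ^+ 2 * ln (1 / eps))^-1)%:E
               <= vc (conv_hull F) eps)%E].
Proof.
have ln2 : 0 < ln 2 :> R by rewrite ln_gt0// ltr1n.
(* With [L := ln (1 / eps)], the choice of [j] and [eps < 1 / 2] give
   [j.+1 * ln 2 <= 3 * L], while [2 ^ j] loses a factor [2] against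
   [1 / eps ^ 2]. *)
exists (ln 2 / 6); split; first by rewrite divr_gt0.
move=> eps e0 e12.
have [j [jlo jhi]] : exists j, (2 ^ j)%:R <= eps ^- 2 /\ eps ^- 2 < (2 ^ j.+1)%:R.
  apply: exists_expn2_le; rewrite invf_ge1 ?exprn_gt0// expr_le1//; lra.
have e2 : 0 < eps ^+ 2 by rewrite exprn_gt0.
have meps : (2 ^ j)%:R * eps ^+ 2 <= 1 by rewrite -ler_pdivlMr// div1r.
have vc_le : (vc (range (signed (@walsh R j))) eps <= j.+1%:R%:E)%E.
  by apply: vc_range_le => //; rewrite card_prod card_bool card_cube expnS.
have vc_ge1 : (1%:E <= vc (range (signed (@walsh R j))) eps)%E.
  by apply: vc_signed_walsh_ge1; lra.
exists {ffun 'I_j -> bool}, (range (signed (@walsh R j))); split.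
- move=> _ [[b y] _ <-] x.
  by rewrite /signed /= normrM normr_sign mul1r normr_walsh.
- by rewrite (lt_le_trans _ vc_ge1) ?(le_lt_trans vc_le) ?ltry ?lte_fin.
apply: le_trans (vc_conv_hull_walsh meps).
set L := ln (1 / eps).
have L2 : ln 2 <= L.
  by rewrite ler_ln ?posrE ?divr_gt0// ler_pdivlMr//; lra.
have L0 : 0 < L by exact: lt_le_trans L2.
have jL : j%:R * ln 2 <= 2 * L.
  have : ln ((2 ^ j)%:R : R) <= ln (eps ^- 2).
    by rewrite ler_ln ?posrE ?invr_gt0 ?ltr0n ?expn_gt0.
  rewrite natrX lnXn// -exprVn lnXn ?invr_gt0// /L div1r.
  by rewrite !mulr_natl.
apply: (@le_trans _ _ ((ln 2 / 6)%:E * j.+1%:R%:E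
    * ((eps ^+ 2 * L)^-1)%:E)%E).
  apply: lee_wpmul2r.
    by rewrite lee_fin invr_ge0 mulr_ge0 ?ltW.
  by apply: lee_wpmul2l; rewrite // lee_fin divr_ge0 ?ltW.
rewrite -!EFinM lee_fin ler_pdivrMr ?mulr_gt0// mulrA.
have half : 1 / 2 <= (2 ^ j)%:R * eps ^+ 2.
  move: jhi; rewrite -[eps ^- 2]div1r ltr_pdivrMr// expnS natrM; lra.
apply: (@le_trans _ _ (1 / 2 * L)); last by rewrite ler_pM2r.
by rewrite -(natr1 j); lra.
Qed.
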